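(* Let $r\in(0,1/2)$. Consider the repetition-coding distributed delay diversity scheme described in the context, with deterministic delays whose relative delay $T_0=|\tau_2-\tau_1|$ satisfies $T_0B_w\ge1$. Put $\Delta_1=\lfloor T_0B_w\rfloor/\lceil T_0B_w\rceil\in[1/2,1]$. Then $$3-\frac{6r}{\Delta_1}\le\liminf_{\mathrm{SNR}\to\infty}-\frac{\log\Pr[I_{R\text{-}TDA}<R]}{\log\mathrm{SNR}}\le\limsup_{\mathrm{SNR}\to\infty}-\frac{\log\Pr[I_{R\text{-}TDA}<R]}{\log\mathrm{SNR}}\le 3-6r.$$ In particular, if $T_0B_w$ is a positive integer, the diversity–multiplexing tradeoff exists and equals $d_{R\text{-}TDA}(r)=3-6r$.
   Context: Network: a source $N_S$, two relays $N_{R_1},N_{R_2}$ and a destination $N_D$. The gains $\alpha_{i,j}$, $i\in\{S,R_1,R_2\}$, $j\in\{R_1,R_2,D\}$, $i\neq j$, are mutually independent zero-mean circularly symmetric complex Gaussian random variables with variances $\sigma^2_{i,j}>0$. For $\mathrm{SNR}>0$ set $\rho_0=\frac23\mathrm{SNR}$. The target rate is $R=r\log(1+\mathrm{SNR}\,\sigma^2_{S,D})$. Relay $R_k$ belongs to the decoding set $\mathcal D(s)$ iff $\frac12\log(1+\rho_0|\alpha_{S,R_k}|^2)\ge R$. Repetition-coding distributed delay diversity: successful relays retransmit the source's own codeword in phase 2, with bandwidth $B_w>0$ and delays $\tau_k$ at the destination. Conditioned on $\mathcal D(s)$, $$I_{R\text{-}TDA}=\frac{1}{2B_w}\int_{-B_w/2}^{B_w/2}\log\left(1+\rho_0|\alpha_{S,D}|^2+\rho_0\Big|\sum_{R_k\in\mathcal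 D(s)}\alpha_{R_k,D}e^{j2\pi f\tau_k}\Big|^2\right)df,$$ where an empty sum equals $0$. The probability $\Pr[I_{R\text{-}TDA}<R]$ averages over the gains, including the randomness of $\mathcal D(s)$. *)

(* Defs.v *)
From HB Require Import structures.
From mathcomp Require Import all_boot all_order all_algebra.
From mathcomp Require Import all_classical all_reals all_analysis.
Set Implicit Arguments. Unset Strict Implicit. Unset Printing Implicit Defensive.
Import Order.TTheory GRing.Theory Num.Theory.
Import numFieldNormedType.Exports.
Local Open Scope classical_set_scope.
Local Open Scope ring_scope.

(* The seven links (i,j), i in {S,R1,R2}, j in {R1,R2,D}, i <> j. *)
Definition link := 'I_7.
Definition l_SR1 : link := @Ordinal 7 0 isT.
Definition l_SR2 : link := @Ordinal 7 1 isT.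
Definition l_SD  : link := @Ordinal 7 2 isT.
Definition l_R1D : link := @Ordinal 7 3 isT.
Definition l_R2D : link := @Ordinal 7 4 isT.
Definition l_R1R2 : link := @Ordinal 7 5 isT.
Definition l_R2R1 : link := @Ordinal 7 6 isT.

Definition mutually_independent d (T : measurableType d) (R : realType)
  (P : probability T R) (I : finType) (X : I -> {RV P >-> R}) : Prop :=
  forall (J : {set I}) (B : I -> set R),
    (forall i, measurable (B i)) ->
    P (\bigcap_(i in [set j | j \in J]) (X i @^-1` B i)) =
    (\prod_(i in J) P (X i @^-1` B i))%E.

(* Circularly symmetric complex Gaussian with variance s2 > 0, written as
   a pair (Re, Im) of independent N(0, s2/2) components; here: each component
   has law N(0, s2/2) (standard deviation sqrt(s2/2)); the independence is
   imposed through [mutually_independent] on all 14 components. *)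
Definition has_law_normal d (T : measurableType d) (R : realType)
  (P : probability T R) (X : {RV P >-> R}) (s2 : R) : Prop :=
  forall A : set R, measurable A ->
    P (X @^-1` A) = normal_prob 0 (Num.sqrt (s2 / 2)) A.

Definition cnorm2 (R : realType) (x y : R) : R := x ^+ 2 + y ^+ 2.

(* Real and imaginary parts of the phase-2 sum over decoding relays
   sum_k [R_k in D] alpha_{R_k,D} e^{j 2 pi f tau_k}, alpha_{R_k,D} = a_k + j b_k. *)
Definition phase2_re (R : realType) (d1 d2 : bool) (a1 b1 a2 b2 tau1 tau2 f : R) : R :=
  (d1%:R) * (a1 * cos (2 * pi * f * tau1) - b1 * sin (2 * pi * f * tau1)) +
  (d2%:R) * (a2 * cos (2 * pi * f * tau2) - b2 * sin (2 * pi * f * tau2)).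
Definition phase2_im (R : realType) (d1 d2 : bool) (a1 b1 a2 b2 tau1 tau2 f : R) : R :=
  (d1%:R) * (a1 * sin (2 * pi * f * tau1) + b1 * cos (2 * pi * f * tau1)) +
  (d2%:R) * (a2 * sin (2 * pi * f * tau2) + b2 * cos (2 * pi * f * tau2)).

Definition rho0 (R : realType) (snr : R) : R := 2 / 3 * snr.

(* target rate R = r log(1 + SNR sigma^2_{S,D}) (natural log; the base is
   irrelevant as long as it is the same everywhere). *)
Definition target_rate (R : realType) (r snr s2SD : R) : R :=
  r * ln (1 + snr * s2SD).

Definition decodes (R : realType) (snr rate x y : R) : bool :=
  rate <= 2^-1 * ln (1 + rho0 snr * cnorm2 x y).

(* The mutual information I_{R-TDA} of the scheme, for given channel gains
   (g l false, g l true) = (Re alpha_l, Im alpha_l). *)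
Definition I_RTDA (R : realType) (Bw tau1 tau2 snr rate : R)
  (g : link -> bool -> R) : R :=
  let d1 := decodes snr rate (g l_SR1 false) (g l_SR1 true) in
  let d2 := decodes snr rate (g l_SR2 false) (g l_SR2 true) in
  (2 * Bw)^-1 * Rintegral lebesgue_measure `[- (Bw / 2), Bw / 2]
    (fun f => ln (1 + rho0 snr * cnorm2 (g l_SD false) (g l_SD true)
       + rho0 snr * cnorm2
           (phase2_re d1 d2 (g l_R1D false) (g l_R1D true)
                            (g l_R2D false) (g l_R2D true) tau1 tau2 f)
           (phase2_im d1 d2 (g l_R1D false) (g l_R1D true)
                            (g l_R2D false) (g l_R2D true) tau1 tau2 f))).

Definition outage_prob d (T : measurableType d) (R : realType)
  (P : probability T R) (G : link * bool -> {RV P >-> R})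
  (s2SD Bw tau1 tau2 r snr : R) : R :=
  fine (P [set w | I_RTDA Bw tau1 tau2 snr (target_rate r snr s2SD)
                     (fun l b => G (l, b) w) < target_rate r snr s2SD]).

Definition diversity_ratio d (T : measurableType d) (R : realType)
  (P : probability T R) (G : link * bool -> {RV P >-> R})
  (s2SD Bw tau1 tau2 r : R) : R -> \bar R :=
  fun snr => (- ln (outage_prob G s2SD Bw tau1 tau2 r snr) / ln snr)%:E.

(* Main.v *)
Require Import Defs.
From HB Require Import structures.
From mathcomp Require Import all_boot all_order all_algebra.
From mathcomp Require Import ring lra zify.
From mathcomp Require Import all_classical all_reals all_analysis.
From mathcomp Require Import measurable_realfun.
Set Implicit Arguments.
Unset Strict Implicit.
Unset Printing Implicit Defensive.
Import Order.TTheory GRing.Theory Num.Theory.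
Import numFieldNormedType.Exports.
Local Open Scope classical_set_scope.
Local Open Scope ring_scope.

(* The diversity equals 3 - 6r for every nonzero relative delay; Delta1 <= 1 then
   gives the stated bounds. Write t for the threshold gain, of order SNR^(2r-1).
   If the two source-relay links and the direct link all have squared gain below t,
   there is an outage; by independence this has probability of order t^3.
   Conversely the phase-2 energy is S + Q cos(2 pi f (tau1 - tau2) + phi) with
   0 <= Q <= S. Outside a set of frequencies of relative measure eta, 1 + cos is at
   least some delta > 0 that does not depend on the gains. So the mutual information
   is at least (1 - eta)/2 * ln (delta * (1 + rho0 * total gain)), and an outage
   forces three independent links (the direct one and, for each relay, the
   relay-destination link if it decodes, the source-relay link if it does not) to have
   gain below a threshold of order SNR^(2r/(1-eta)-1). Let eta -> 0. *)

(** * Limits inferior and superior along a filter *)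

Section limits.
Context {T : topologicalType} {R : realType}.
Implicit Types (f : T -> \bar R) (F : set_system T).
Local Open Scope ereal_scope.

Lemma limf_esup_le f F l : (\forall x \near F, f x <= l) -> limf_esup f F <= l.
Proof.
move=> Fl; rewrite limf_esupE; apply: ge_ereal_inf.
exists (ereal_sup (f @` [set x | f x <= l])).
  by exists [set x | f x <= l].
by apply: ge_ereal_sup => _ [x /= xl <-].
Qed.

Lemma le_limf_einf f F l : (\forall x \near F, l <= f x) -> l <= limf_einf f F.
Proof.
move=> Fl; rewrite limf_einfE; apply: le_ereal_sup_tmp.
exists (ereal_inf (f @` [set x | l <= f x])).
  by exists [set x | l <= f x].
by apply: le_ereal_inf_tmp => _ [x /= xl <-].
Qed.

Lemma limf_einf_le_esup f F : ProperFilter F -> limf_einf f F <= limf_esup f F.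
Proof.
move=> PF; rewrite limf_einfE limf_esupE.
apply: ge_ereal_sup => _ [A FA <-]; apply: le_ereal_inf_tmp => _ [B FB <-].
have [x [Ax Bx]] := filter_ex (filterI FA FB).
apply: (@le_trans _ _ (f x)); first by apply: ereal_inf_lbound; exists x.
by apply: ereal_sup_ubound; exists x.
Qed.

(** The eventual bounds put [l] below the limit inferior and the limit superior below [l];
    properness of the filter closes the chain. *)
Lemma limf_einf_esup_unique (g : T -> R) F (l : R) : ProperFilter F ->
  (forall e, (0 < e)%R -> \forall x \near F, (l - e <= g x <= l + e)%R) ->
  limf_einf (EFin \o g) F = l%:E /\ limf_esup (EFin \o g) F = l%:E.
Proof.
move=> PF gl.
have inf_ge : l%:E <= limf_einf (EFin \o g) F.
  apply/lee_addgt0Pr => e e0; rewrite -leeBlDr//.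
  apply: le_limf_einf; near=> x; rewrite /= -EFinB lee_fin.
  by have /andP[] : (l - e <= g x <= l + e)%R by near: x; exact: gl.
have sup_le : limf_esup (EFin \o g) F <= l%:E.
  apply/lee_addgt0Pr => e e0.
  apply: limf_esup_le; near=> x; rewrite /= -EFinD lee_fin.
  by have /andP[] : (l - e <= g x <= l + e)%R by near: x; exact: gl.
have le := limf_einf_le_esup (EFin \o g) PF.
by split; apply/eqP; rewrite eq_le ?inf_ge ?sup_le ?andbT/=;
  [exact: le_trans sup_le|exact: le_trans le].
Unshelve. all: by end_near. Qed.

End limits.

(** * Gaussian mass of short symmetric intervals *)

Section normal_bounds.
Context {R : realType}.
Implicit Types s a : R.
Notation mu := (@lebesgue_measure R).

Let mu_sym a : 0 <= a -> mu `]- a, a[%classic = (2 * a)%:E.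
Proof.
move=> a0; rewrite lebesgue_measure_itv/= lte_fin; case: ifPn => [_|].
  by rewrite -EFinD opprK mulr_natl mulr2n.
rewrite -leNgt => a0'; congr EFin; lra.
Qed.

Lemma normal_prob_sym_itv_le s a : s != 0 -> 0 <= a ->
  (normal_prob 0 s `](- a)%R, a[%classic <= (2 * normal_peak s * a)%:E)%E.
Proof.
move=> s0 a0; apply: (@le_trans _ _ (\int[mu]_(x in `](- a)%R, a[) (normal_peak s)%:E)%E).
  apply: ge0_le_integral => //=.
  - by move=> x _; rewrite lee_fin normal_pdf_ge0.
  - by apply/measurable_EFinP; apply: measurable_funTS; exact: measurable_normal_pdf.
  - by move=> x _; rewrite lee_fin normal_pdf_ub.
rewrite integral_cst//= mu_sym// -EFinM lee_fin; lra.
Qed.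

(** The density decreases in [|x|], so inside []-1, 1[] it is at least its value at [1], a constant
    independent of [a]. *)
Lemma normal_prob_sym_itv_ge s a : s != 0 -> 0 <= a <= 1 ->
  ((2 * normal_pdf 0 s 1 * a)%:E <= normal_prob 0 s `](- a)%R, a[%classic)%E.
Proof.
move=> s0 /andP[a0 a1].
apply: (@le_trans _ _ (\int[mu]_(x in `](- a)%R, a[) (normal_pdf 0 s 1)%:E)%E).
  rewrite integral_cst//= mu_sym// -EFinM lee_fin; lra.
apply: ge0_le_integral => //=.
- by move=> x _; rewrite lee_fin normal_pdf_ge0.
- by apply/measurable_EFinP; apply: measurable_funTS; exact: measurable_normal_pdf.
- move=> x; rewrite in_itv/= => /andP[ax xa]; rewrite lee_fin !normal_pdfE//.
  rewrite ler_pM2l ?normal_peak_gt0// /normal_fun ler_expR !subr0 !mulNr lerN2.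
  rewrite ler_pM2r ?invr_gt0 ?pmulrn_lgt0 ?exprn_even_gt0//; nra.
Qed.

End normal_bounds.

(** * Polar form, and frequencies at which a cosine stays away from [-1] *)

Lemma odd_int_offset (k : int) (n : nat) : `|2 * k + 1| < n%:Z ->
  exists2 j : nat, j%:Z - n%:Z = k & (j < 2 * n)%N.
Proof. by move=> kn; exists (absz (k + n%:Z)); lia. Qed.

Section trigonometry.
Context {R : realType}.
Implicit Types x y p q s t phi T : R.

Lemma polar_coordinates p q : exists2 phi, `|phi| <= pi &
  p = Num.sqrt (p ^+ 2 + q ^+ 2) * cos phi /\
  q = Num.sqrt (p ^+ 2 + q ^+ 2) * sin phi.
Proof.
set m := Num.sqrt _.
have m2 : m ^+ 2 = p ^+ 2 + q ^+ 2 by rewrite sqr_sqrtr// addr_ge0// sqr_ge0.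
have [m0|m0] := eqVneq m 0.
  exists 0; first by rewrite normr0 pi_ge0.
  by rewrite m0 !mul0r; move: m2; rewrite m0 => /eqP; rewrite expr0n/= eq_sym
    paddr_eq0 ?sqr_ge0// !sqrf_eq0 => /andP[/eqP-> /eqP->].
have mp : 0 < m by rewrite lt_neqAle eq_sym m0 sqrtr_ge0.
have pm : -1 <= p / m <= 1.
  by rewrite ler_pdivrMr// ler_pdivlMr//; have := sqr_ge0 q; nra.
have cosE : cos (acos (p / m)) = p / m by rewrite acosK// in_itv.
have sinE : sin (acos (p / m)) = `|q| / m.
  have -> : `|q| / m = Num.sqrt ((q / m) ^+ 2).
    by rewrite sqrtr_sqr normrM normfV (gtr0_norm mp).
  rewrite sin_acos//; congr Num.sqrt; apply: (mulfI (expf_neq0 2 m0)).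
  by rewrite mulrBr mulr1 -!exprMn mulrCA divff// mulr1 mulrCA divff// mulr1 m2; ring.
(* [acos] only sees the cosine and fixes the angle up to sign; the sign of [q] decides. *)
have [q0|q0] := lerP 0 q.
  exists (acos (p / m)); first by rewrite ger0_norm ?acos_ge0// acos_lepi.
  by rewrite cosE sinE ger0_norm// !(mulrC m) !divfK.
exists (- acos (p / m)); first by rewrite normrN ger0_norm ?acos_ge0// acos_lepi.
by rewrite cosN sinN cosE sinE ltr0_norm// mulNr opprK !(mulrC m) !divfK.
Qed.

Lemma cos_shift_odd_pi t (k : int) : cos (t - (2 * k + 1)%:~R * pi) = - cos t.
Proof.
have -> : t - (2 * k + 1)%:~R * pi = t - pi + (- k)%:~R * (pi *+ 2).
  by rewrite intrD intrM mulrNz -mulr_natl; ring.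
have cos_per (u : R) (n : nat) : cos (u + n%:~R * (pi *+ 2)) = cos u.
  by rewrite -pmulrn mulr_natl; exact: (periodicn (@cosD2pi R)).
(* Periodicity is available for natural multiples; a negative multiple is undone by adding the
   period back. *)
have -> : cos (t - pi + (- k)%:~R * (pi *+ 2)) = cos (t - pi).
  case: (- k) => n; first exact: cos_per.
  by rewrite NegzE mulrNz mulNr -(cos_per (_ - _ * _) n.+1) subrK.
by rewrite -[t in RHS](subrK pi) cosDpi opprK.
Qed.

(** With [k] the floor of [t / (2 pi)], the number [t] is within [pi] of [(2 k + 1) pi]. Shifting by
    that multiple flips the sign of the cosine, which is even and decreases on [[0, pi]]. *)
Lemma cos_away_from_odd_pi s t : 0 <= s <= pi ->
  (forall k : int, s <= `|t - (2 * k + 1)%:~R * pi|) -> 1 - cos s <= 1 + cos t.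
Proof.
move=> /andP[s0 spi] /(_ (Num.floor (t / (2 * pi)))).
set k := Num.floor _; set u := (t - _) => su.
have pi0 : 0 < 2 * pi :> R by rewrite mulr_gt0// pi_gt0.
have upi : `|u| <= pi.
  have := Num.Theory.floor_le (t / (2 * pi)).
  have := Num.Theory.lt_succ_floor (t / (2 * pi)).
  rewrite -/k ltr_pdivrMr// ler_pdivlMr// intrD => h1 h2.
  by rewrite /u intrD intrM ler_norml; apply/andP; split; nra.
have : cos `|u| <= cos s.
  by rewrite leNgt ltr_cos ?in_itv/= ?s0 ?spi ?normr_ge0 ?upi// -leNgt.
rewrite cos_norm cos_shift_odd_pi; lra.
Qed.


(* One removes an arc of small length around each frequency where the cosine is [-1];
   the number of such frequencies is bounded uniformly in [phi]. *)
Lemma cos_away_measure T (B eta : R) : T != 0 -> 0 < B -> 0 < eta ->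
  exists2 delta, 0 < delta <= 1 & forall phi, `|phi| <= pi ->
  exists A : set R, [/\ measurable A, A `<=` `[- (B / 2), B / 2]%classic,
    (((1 - eta) * B)%:E <= lebesgue_measure A)%E &
    forall f, A f -> delta <= 1 + cos (2 * pi * f * T + phi)].
Proof.
move=> T0 B0 eta0.
have pi0 : 0 < pi :> R := pi_gt0 R.
have nT0 : 0 < `|T| by rewrite normr_gt0.
(* The phase is at most [pi * (|T| * B + 1)] in modulus; the extra [pi] leaves room for the arc
   radius [s <= pi / 2]. *)
pose N := `|Num.ceil (`|T| * B + 2)|%N.
have NE : `|T| * B + 2 <= N%:R.
  apply: le_trans (Num.Theory.ceil_ge _) _.
  by rewrite /N natr_absz ler_int ler_norm.
have N0 : 0 < N%:R :> R.
  by apply: lt_le_trans NE; rewrite addr_gt0// mulr_gt0.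
(* the phase stays below [N pi] in absolute value, so [2 N] arcs suffice *)
pose s := Num.min (pi / 2) (eta * B * pi * `|T| / (2 * N%:R)).
have s0 : 0 < s.
  by rewrite lt_min !divr_gt0//= ?mulr_gt0.
have spi : s <= pi / 2 by rewrite ge_min lexx.
have sle : s * (2 * N%:R) <= eta * B * pi * `|T|.
  by rewrite -ler_pdivlMr ?mulr_gt0// ge_min lexx orbT.
have sP : 0 <= s <= pi by apply/andP; split; lra.
have cs0 : 0 <= cos s.
  by apply: cos_ge0_pihalf; apply/andP; split; lra.
have cs1 : cos s < 1.
  by rewrite -[ltRHS]cos0 ltr_cos// !in_itv/= ?lexx ?pi_ge0//; apply/andP; split; lra.
exists (1 - cos s); first by apply/andP; split; lra.
move=> phi phipi.
(* centre, in the variable [f], of the arc around [(2 (i - N) + 1) pi] *)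
pose c (i : nat) : R := ((2 * (i%:Z - N%:Z) + 1)%:~R * pi - phi) / (2 * pi * T).
pose h : R := s / (2 * pi * `|T|).
have h0 : 0 < h by rewrite divr_gt0// !mulr_gt0.
pose U : set R := \big[setU/set0]_(i < 2 * N) `]c i - h, c i + h[%classic.
have mU : measurable U by apply: bigsetU_measurable.
have arc_le i : (lebesgue_measure `](c i - h)%R, (c i + h)%R[%classic <= (2 * h)%:E)%E.
  by rewrite lebesgue_measure_itv/= lte_fin; case: ifPn => _;
    rewrite -?EFinD lee_fin; lra.
(* Union bound: the [2 N] arcs of length [2 h] have total length [2 N s / (pi |T|)], which the
   choice of [s] keeps below [eta * B]. *)
have Ule : (lebesgue_measure U <= (eta * B)%:E)%E.
  apply: (le_trans (@Boole_inequality _ _ _ lebesgue_measure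
    (fun i => `]c i - h, c i + h[%classic) (2 * N) _)) => //.
  apply: (@le_trans _ _ (\sum_(i < 2 * N) (2 * h)%:E)%E).
    by apply: lee_sum => i _; exact: arc_le.
  rewrite sumEFin lee_fin sumr_const card_ord -[leLHS]mulr_natr natrM.
  have piT0 : 0 < pi * `|T| by rewrite mulr_gt0.
  rewrite -(ler_pM2r piT0) [leRHS]mulrA.
  rewrite (_ : _ * (pi * `|T|) = h * (2 * pi * `|T|) * (2 * N%:R)); last by ring.
  by rewrite divfK// gt_eqF// -mulrA mulr_gt0.
exists (`[- (B / 2), B / 2]%classic `\` U); split.
- exact: measurableD.
- by move=> x [].
- have muW : lebesgue_measure `[- (B / 2), B / 2]%classic = B%:E.
    rewrite lebesgue_measure_itv/= lte_fin ifT; last by lra.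
    by rewrite -EFinD; congr EFin; field.
  rewrite mulrBl mul1r EFinB leeBlDr// -muW.
  apply: (@le_trans _ _ (lebesgue_measure ((`[- (B / 2), B / 2]%classic `\` U) `|` U))).
    apply: le_measure; rewrite ?inE//=.
      by apply: measurableU => //; exact: measurableD.
    by move=> x Wx; have [Ux|nUx] := pselect (U x); [right|left].
  apply: le_trans (measureU2 _ _ _) _ => //; first exact: measurableD.
  by rewrite leeD2l.
move=> f [/= Wf nUf]; apply: cos_away_from_odd_pi => // k.
rewrite leNgt; apply/negP => ltks; apply: nUf.
set t := 2 * pi * f * T + phi in ltks.
have tle : `|t| <= pi * (`|T| * B) + pi.
  apply: le_trans (ler_normD _ _) _; apply: lerD => //.
  rewrite !normrM (ger0_norm (ler0n _ 2)) (gtr0_norm pi0).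
  have : `|f| <= B / 2 by move: Wf; rewrite in_itv/= ler_norml.
  have := mulr_gt0 pi0 nT0; nra.
have : `|(2 * k + 1)%:~R| * pi < N%:R * pi :> R.
  have : `|(2 * k + 1)%:~R * pi| <= `|t| + `|t - (2 * k + 1)%:~R * pi|.
    by rewrite -[X in `|X| <= _](subKr t); exact: ler_normB.
  rewrite normrM (gtr0_norm pi0) => le1; nra.
rewrite ltr_pM2r// -intr_norm -[ltRHS]/(N%:Z%:~R) ltr_int => kN.
(* The odd multiple close to [t] is thus one of the [2 N] that were listed, so [f] lies in the arc
   of index [j], which was removed. *)
have [j jE jN] := odd_int_offset kN.
rewrite /U -(bigcup_mkord (2 * N) (fun i => `]c i - h, c i + h[%classic)); exists j => //=.
rewrite in_itv/= -ltr_distlC.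
have -> : c j - f = ((2 * k + 1)%:~R * pi - t) / (2 * pi * T).
  have nz : 2 * pi * T != 0 by rewrite mulf_neq0// gt_eqF// mulr_gt0.
  by rewrite /c /t jE -[X in _ - X = _](mulfK nz) -mulrBl; congr (_ / _); ring.
rewrite normrM distrC.
by rewrite /h normfV normrM (@gtr0_norm _ (2 * pi)) ?ltr_pM2r ?invr_gt0 ?mulr_gt0.
Qed.

End trigonometry.

(** * Lower bounds for integrals, and their measurability in a parameter *)

Section integrals.
Context {R : realType}.
Notation mu := (@lebesgue_measure R).

Lemma Rintegral_ge_subset (a b c m : R) (h : R -> R) (A : set R) :
  continuous h -> (forall x, 0 <= h x) -> measurable A ->
  A `<=` `[a, b]%classic -> 0 <= c -> (m%:E <= mu A)%E ->
  (forall x, A x -> c <= h x) -> c * m <= \int[mu]_(x in `[a, b]) h x.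
Proof.
move=> ch h0 mA Aab c0 mmu cA.
have ih : mu.-integrable `[a, b]%classic (EFin \o h).
  apply: continuous_compact_integrable; first exact: segment_compact.
  exact: continuous_subspaceT.
have mh : measurable_fun setT (EFin \o h).
  by apply/measurable_EFinP; exact: continuous_measurable_fun.
rewrite -lee_fin /Rintegral fineK; last exact: integrable_fin_num ih.
apply: (@le_trans _ _ (\int[mu]_(x in A) c%:E)%E).
  by rewrite integral_cst// EFinM lee_wpmul2l// lee_fin.
apply: (@le_trans _ _ (\int[mu]_(x in A) (h x)%:E)%E).
  apply: ge0_le_integral => //=.
  - by apply: measurable_funTS.
apply: ge0_subset_integral => //=; first exact: measurable_funTS.
by move=> x _; rewrite lee_fin.
Qed.

(** Tonelli measurability, applied to the integrand times the indicator of [D] so that the integral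
    runs over the whole line. *)
Lemma measurable_fun_Rintegral_param (d : measure_display) (T : measurableType d)
    (k : T * R -> R) (D : set R) : measurable D ->
  measurable_fun setT k -> (forall z, 0 <= k z) ->
  measurable_fun setT (fun w => \int[mu]_(x in D) k (w, x)).
Proof.
move=> mD mk k0; rewrite /Rintegral.
apply: (measurableT_comp (@fine_measurable R setT measurableT)).
pose K (z : T * R) : \bar R := (k z * \1_D z.2)%:E.
have -> : (fun w => \int[mu]_(x in D) (k (w, x))%:E)%E = fubini_F mu K.
  apply/funext => w; rewrite /fubini_F [LHS]integral_mkcond.
  apply: eq_integral => x _. by rewrite epatch_indic /K/= EFinM.
apply: measurable_fun_fubini_tonelli_F.
  apply/measurable_EFinP/measurable_funM => //.
  by apply: measurableT_comp => //; exact: measurable_indic.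
by move=> z; rewrite lee_fin mulr_ge0.
Qed.

End integrals.

(** * Energy received in phase 2 *)

Section phase2.
Context {R : realType}.
Implicit Types (a b f tau x y : R) (d : bool).

Lemma cnorm2_ge0 x y : 0 <= cnorm2 x y.
Proof. by rewrite addr_ge0 ?sqr_ge0. Qed.

(** The cross term is twice the real part of [alpha_1 * conj(alpha_2) * e^(j 2 pi f (tau1 - tau2))],
    so only the relative delay matters. *)
Lemma cnorm2_phase2 d1 d2 a1 b1 a2 b2 tau1 tau2 f :
  cnorm2 (phase2_re d1 d2 a1 b1 a2 b2 tau1 tau2 f)
         (phase2_im d1 d2 a1 b1 a2 b2 tau1 tau2 f) =
  d1%:R * cnorm2 a1 b1 + d2%:R * cnorm2 a2 b2 +
  2 * (d1 && d2)%:R * ((a1 * a2 + b1 * b2) * cos (2 * pi * f * (tau1 - tau2))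
     - (b1 * a2 - a1 * b2) * sin (2 * pi * f * (tau1 - tau2))).
Proof.
rewrite (mulrBr (2 * pi * f)) cosB sinB.
(* Inserting [cos ^ 2 + sin ^ 2] into the squared gains makes the claim a polynomial identity in the
   sines and cosines. *)
have turn (n t : R) : n = n * (cos t ^+ 2 + sin t ^+ 2).
  by rewrite cos2Dsin2 mulr1.
rewrite [cnorm2 a1 b1](turn _ (2 * pi * f * tau1)).
rewrite [cnorm2 a2 b2](turn _ (2 * pi * f * tau2)).
by rewrite /cnorm2 /phase2_re /phase2_im; case: d1; case: d2 => /=; ring.
Qed.

(** With both relays active the cross term is [2 * m * cos], where [2 * m] is at most the sum of the
    squared gains by the arithmetic-geometric mean inequality; the energy is then at least that sum
    times [min(1, 1 + cos)]. Otherwise there is no cross term and [delta <= 1] suffices. The phase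
    [phi] depends on the gains but not on [f]. *)
Lemma cnorm2_phase2_ge d1 d2 a1 b1 a2 b2 tau1 tau2 :
  exists2 phi, `|phi| <= pi & forall delta f, delta <= 1 ->
    delta <= 1 + cos (2 * pi * f * (tau1 - tau2) + phi) ->
    delta * (d1%:R * cnorm2 a1 b1 + d2%:R * cnorm2 a2 b2) <=
    cnorm2 (phase2_re d1 d2 a1 b1 a2 b2 tau1 tau2 f)
           (phase2_im d1 d2 a1 b1 a2 b2 tau1 tau2 f).
Proof.
have [phi phipi] := polar_coordinates (a1 * a2 + b1 * b2) (b1 * a2 - a1 * b2).
set m := Num.sqrt _ => -[pE qE]; exists phi => // delta f delta1 hd.
rewrite cnorm2_phase2 pE qE.
have -> : m * cos phi * cos (2 * pi * f * (tau1 - tau2)) -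
    m * sin phi * sin (2 * pi * f * (tau1 - tau2)) =
    m * cos (2 * pi * f * (tau1 - tau2) + phi) by rewrite cosD; ring.
have n1 := cnorm2_ge0 a1 b1; have n2 := cnorm2_ge0 a2 b2.
have m0 : 0 <= m by rewrite sqrtr_ge0.
have mle : 2 * m <= cnorm2 a1 b1 + cnorm2 a2 b2.
  have m2 : m ^+ 2 = cnorm2 a1 b1 * cnorm2 a2 b2.
    by rewrite sqr_sqrtr ?addr_ge0 ?sqr_ge0// /cnorm2; ring.
  rewrite -(ler_pXn2r (n := 2)) ?nnegrE//; [|by rewrite mulr_ge0|by rewrite addr_ge0].
  have := sqr_ge0 (cnorm2 a1 b1 - cnorm2 a2 b2).
  by rewrite exprMn m2; nra.
move: (cos _) hd => C hd; move: (cnorm2 a1 b1) (cnorm2 a2 b2) n1 n2 mle => u v n1 n2 mle.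
by case: d1; case: d2 => /=; nra.
Qed.

Lemma cnorm2_phase2_continuous d1 d2 a1 b1 a2 b2 tau1 tau2 :
  continuous (fun f => cnorm2 (phase2_re d1 d2 a1 b1 a2 b2 tau1 tau2 f)
                              (phase2_im d1 d2 a1 b1 a2 b2 tau1 tau2 f)).
Proof.
under eq_fun do rewrite cnorm2_phase2.
have clin : continuous (fun f : R => 2 * pi * f * (tau1 - tau2)).
  by move=> f; apply: cvgMl; apply: cvgMr; exact: cvg_id.
move=> f; apply: cvgD; first exact: cvg_cst.
apply: cvgMr; apply: cvgB; apply: cvgMr.
  exact: (continuous_comp (clin f) (@continuous_cos R _)).
exact: (continuous_comp (clin f) (@continuous_sin R _)).
Qed.

End phase2.

(** * The outage event for given gains *)

Section outage.
Context {R : realType}.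
Implicit Types (snr rate : R) (g : link -> bool -> R).

Definition rtda_integrand (snr x y : R) (d1 d2 : bool)
    (a1 b1 a2 b2 tau1 tau2 f : R) : R :=
  ln (1 + rho0 snr * cnorm2 x y + rho0 snr *
    cnorm2 (phase2_re d1 d2 a1 b1 a2 b2 tau1 tau2 f)
           (phase2_im d1 d2 a1 b1 a2 b2 tau1 tau2 f)).

Lemma rho0_ge0 snr : 0 <= snr -> 0 <= rho0 snr.
Proof. by move=> snr0; rewrite /rho0; lra. Qed.

Lemma rtda_integrand_ge0 snr x y d1 d2 a1 b1 a2 b2 tau1 tau2 f : 0 <= snr ->
  0 <= rtda_integrand snr x y d1 d2 a1 b1 a2 b2 tau1 tau2 f.
Proof.
move=> /rho0_ge0 rho; apply: ln_ge0.
by rewrite -addrA lerDl addr_ge0// mulr_ge0// cnorm2_ge0.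
Qed.

Lemma rtda_integrand_continuous snr x y d1 d2 a1 b1 a2 b2 tau1 tau2 : 0 <= snr ->
  continuous (rtda_integrand snr x y d1 d2 a1 b1 a2 b2 tau1 tau2).
Proof.
move=> /rho0_ge0 rho f.
pose k f' := 1 + rho0 snr * cnorm2 x y + rho0 snr *
    cnorm2 (phase2_re d1 d2 a1 b1 a2 b2 tau1 tau2 f')
           (phase2_im d1 d2 a1 b1 a2 b2 tau1 tau2 f').
have ck : {for f, continuous k}.
  apply: cvgD; first exact: cvg_cst.
  by apply: cvgMr; exact: cnorm2_phase2_continuous.
apply: (@continuous_comp _ _ _ k (@ln R) f ck).
apply: continuous_ln; apply: (@lt_le_trans _ _ 1) => //=.
by rewrite /k -addrA lerDl addr_ge0// mulr_ge0// cnorm2_ge0.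
Qed.

(** By contraposition: otherwise the integrand is at least [2 * rate / (1 - eta)] on a set of
    measure [(1 - eta) * Bw], and the prefactor [1 / (2 * Bw)] yields at least [rate]. Choosing
    [delta] before [snr] and the gains keeps the bound uniform. *)
Lemma outage_gain_lt (Bw tau1 tau2 eta : R) :
  0 < Bw -> tau1 != tau2 -> 0 < eta < 1 ->
  exists2 delta, 0 < delta <= 1 & forall snr rate g,
    let d1 := decodes snr rate (g l_SR1 false) (g l_SR1 true) in
    let d2 := decodes snr rate (g l_SR2 false) (g l_SR2 true) in
    0 <= snr -> 0 <= rate -> I_RTDA Bw tau1 tau2 snr rate g < rate ->
    delta * (1 + rho0 snr * (cnorm2 (g l_SD false) (g l_SD true) +
      (d1%:R * cnorm2 (g l_R1D false) (g l_R1D true) +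
       d2%:R * cnorm2 (g l_R2D false) (g l_R2D true))))
    < expR (2 * rate / (1 - eta)).
Proof.
move=> Bw0 tau12 /andP[eta0 eta1].
have tau0 : tau1 - tau2 != 0 by rewrite subr_eq0.
have [delta /andP[delta0 delta1] away] := cos_away_measure tau0 Bw0 eta0.
exists delta; first by rewrite delta0.
move=> snr rate g d1 d2 snr0 rate0; rewrite !ltNge; apply: contra.
set X := 1 + _ => leX; have rho := rho0_ge0 snr0.
rewrite /I_RTDA -/d1 -/d2.
have [phi phipi hphi] := cnorm2_phase2_ge d1 d2 (g l_R1D false) (g l_R1D true)
  (g l_R2D false) (g l_R2D true) tau1 tau2.
have [A [mA Asub muA hA]] := away _ phipi.
have c0 : 0 <= 2 * rate / (1 - eta).
  by rewrite divr_ge0 ?mulr_ge0// subr_ge0 ltW.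
have := @Rintegral_ge_subset R (- (Bw / 2)) (Bw / 2) (2 * rate / (1 - eta)) _ _ A
  (@rtda_integrand_continuous snr (g l_SD false) (g l_SD true) d1 d2
     (g l_R1D false) (g l_R1D true) (g l_R2D false) (g l_R2D true)
     tau1 tau2 snr0)
  (fun f => @rtda_integrand_ge0 snr _ _ _ _ _ _ _ _ _ _ f snr0) mA Asub c0 muA.
rewrite ler_pdivlMl ?mulr_gt0// => h; apply: le_trans (h _); last first.
  move=> f Af; rewrite /rtda_integrand -[leLHS]expRK ler_ln ?posrE ?expR_gt0//; last first.
    apply: (@lt_le_trans _ _ 1) => //.
    by rewrite -addrA lerDl addr_ge0// mulr_ge0// cnorm2_ge0.
  (* The factor [delta] is needed only for the phase-2 energy; on the two other terms [delta <= 1]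
     lets it be dropped. *)
  apply: le_trans leX _; have := hphi _ f delta1 (hA _ Af).
  rewrite /X; have := cnorm2_ge0 (g l_SD false) (g l_SD true).
  move: (cnorm2 _ _) (cnorm2 _ _) (_ + _) => n0 n S n00 hS.
  by have := mulr_ge0 rho n00; nra.
have -> : 2 * rate / (1 - eta) * ((1 - eta) * Bw) = 2 * Bw * rate.
  by rewrite mulrA divfK ?subr_eq0 ?gt_eqF//; ring.
exact: lexx.
Qed.

(** Each of the three squared gains is below [2 * a ^ 2]. Hence no relay decodes, the integrand is
    constant in [f], and the direct link alone cannot reach the rate. *)
Lemma small_gains_outage (Bw tau1 tau2 snr rate a : R) g :
  0 < Bw -> 0 < snr -> 0 <= a ->
  2 * rho0 snr * a ^+ 2 <= expR (2 * rate) - 1 ->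
  (forall l b, l \in [:: l_SR1; l_SR2; l_SD] -> `|g l b| < a) ->
  I_RTDA Bw tau1 tau2 snr rate g < rate.
Proof.
move=> Bw0 snr0 a0 ha small.
have rho : 0 < rho0 snr by rewrite /rho0; lra.
have small_log l : l \in [:: l_SR1; l_SR2; l_SD] ->
    2^-1 * ln (1 + rho0 snr * cnorm2 (g l false) (g l true)) < rate.
  move=> lL; have := small l false lL; have := small l true lL.
  move: (g l true) (g l false) => y x; rewrite !ltr_norml => /andP[y1 y2] /andP[x1 x2].
  rewrite ltr_pdivrMl// -[ltRHS]expRK ltr_ln ?posrE ?expR_gt0//.
    have : cnorm2 x y < 2 * a ^+ 2 by rewrite /cnorm2; nra.
    by rewrite -(ltr_pM2l rho); lra.
  by rewrite ltr_pwDl// mulr_ge0 ?cnorm2_ge0// ltW.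
have nodec l : l \in [:: l_SR1; l_SR2; l_SD] ->
    decodes snr rate (g l false) (g l true) = false.
  by move=> lL; apply/negbTE; rewrite /decodes -ltNge small_log.
rewrite /I_RTDA !nodec//=.
under eq_Rintegral do
  rewrite cnorm2_phase2 !mul0r mulr0 mul0r !addr0 mulr0 addr0.
rewrite Rintegral_cst//=.
rewrite lebesgue_measure_itv/= lte_fin ifT; last by lra.
have -> : fine (Bw / 2 - - (Bw / 2))%:E = Bw by rewrite /=; field.
rewrite (_ : _ * _ = 2^-1 * ln (1 + rho0 snr * cnorm2 (g l_SD false) (g l_SD true))).
  exact: small_log.
by rewrite invfM -mulrA (mulrC Bw^-1) mulfK ?gt_eqF.
Qed.

(** The integrand is jointly measurable in outcome and frequency, the decoding bits entering as
    measurable [0]-[1] valued factors. *)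
Lemma measurable_outage (d : measure_display) (T : measurableType d)
    (P : probability T R) (G : link * bool -> {RV P >-> R})
    (Bw tau1 tau2 snr rate : R) : 0 <= snr ->
  measurable [set w | I_RTDA Bw tau1 tau2 snr rate (fun l b => G (l, b) w) < rate].
Proof.
move=> snr0.
have mG i : measurable_fun setT (G i) by [].
pose dec l w := decodes snr rate (G (l, false) w) (G (l, true) w).
have mc2 l : measurable_fun setT (fun w => cnorm2 (G (l, false) w) (G (l, true) w)).
  by apply: measurable_funD; exact: measurable_funX.
have mdec l : measurable_fun setT (fun w => (dec l w)%:R : R).
  have -> : (fun w => (dec l w)%:R : R) = (fun w => if dec l w then 1 else 0).
    by apply/funext => w; case: (dec l w).
  apply: measurable_fun_ifT => //; apply: measurable_fun_ler => //.
  apply: measurable_funM => //; apply: measurableT_comp => //.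
  by apply: measurable_funD => //; exact: measurable_funM.
pose k (z : T * R) := rtda_integrand snr (G (l_SD, false) z.1) (G (l_SD, true) z.1)
  (dec l_SR1 z.1) (dec l_SR2 z.1) (G (l_R1D, false) z.1) (G (l_R1D, true) z.1)
  (G (l_R2D, false) z.1) (G (l_R2D, true) z.1) tau1 tau2 z.2.
have m1 (h : T -> R) : measurable_fun setT h ->
    measurable_fun setT (fun z : T * R => h z.1).
  by move=> mh; apply: measurableT_comp.
have mang tau : measurable_fun setT (fun z : T * R => 2 * pi * z.2 * tau).
  by apply: measurable_funM => //; apply: measurable_funM.
have mcos tau : measurable_fun setT (fun z : T * R => cos (2 * pi * z.2 * tau)).
  by apply: measurableT_comp => //; apply: continuous_measurable_fun; exact: continuous_cos.
have msin tau : measurable_fun setT (fun z : T * R => sin (2 * pi * z.2 * tau)).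
  by apply: measurableT_comp => //; apply: continuous_measurable_fun; exact: continuous_sin.
have mk : measurable_fun setT k.
  apply: measurableT_comp => //; apply: measurable_funD.
    apply: (m1 (fun w => 1 + rho0 snr * cnorm2 (G (l_SD, false) w) (G (l_SD, true) w))).
    by apply: measurable_funD => //; exact: measurable_funM.
  apply: measurable_funM => //.
  apply: measurable_funD; apply: measurable_funX; apply: measurable_funD;
    (apply: measurable_funM; first exact: (m1 _ (mdec _)));
    [apply: measurable_funB|apply: measurable_funB|
     apply: measurable_funD|apply: measurable_funD];
    by apply: measurable_funM => //; exact: (m1 _ (mG _)).
have mI : measurable_fun setT
    (fun w => I_RTDA Bw tau1 tau2 snr rate (fun l b => G (l, b) w)).
  apply: measurable_funM => //.
  apply: (@measurable_fun_Rintegral_param _ _ _ k) => // z.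
  exact: rtda_integrand_ge0.
rewrite -[X in measurable X]setTI.
exact: (measurable_fun_ltr mI (measurable_cst rate)) measurableT [set true] _.
Qed.

End outage.

(** * Probability that several links are weak at once *)

Section small_gains.
Context (d : measure_display) (T : measurableType d) (R : realType).
Context (P : probability T R) (G : link * bool -> {RV P >-> R}).
Context (sigma2 : link -> R).
Hypothesis sigma2_gt0 : forall l, 0 < sigma2 l.
Hypothesis indepG : mutually_independent G.
Hypothesis normG : forall l b, has_law_normal (G (l, b)) (sigma2 l).
Implicit Types (a : R) (L : {set link}).

Let std_neq0 l : Num.sqrt (sigma2 l / 2) != 0.
Proof. by rewrite gt_eqF// sqrtr_gt0 divr_gt0. Qed.

Lemma gain_prob_le : exists2 C, 0 < C & forall i a, 0 <= a ->
  (P (G i @^-1` `](- a)%R, a[%classic) <= (C * a)%:E)%E.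
Proof.
pose C l := 2 * normal_peak (Num.sqrt (sigma2 l / 2)).
have C0 l : 0 < C l by rewrite mulr_gt0// normal_peak_gt0.
(* A sum over the finitely many links dominates every single constant. *)
exists (\sum_l C l).
  by rewrite (bigD1 l_SD)//= ltr_pwDl// sumr_ge0// => l _; exact: ltW.
move=> [l b] a a0; rewrite normG//.
apply: le_trans (normal_prob_sym_itv_le (std_neq0 l) a0) _.
rewrite lee_fin ler_wpM2r// -/(C l) (bigD1 l)//= lerDl.
by rewrite sumr_ge0// => j _; exact: ltW.
Qed.

Lemma gain_prob_ge : exists2 c, 0 < c & forall i a, 0 <= a <= 1 ->
  ((c * a)%:E <= P (G i @^-1` `](- a)%R, a[%classic))%E.
Proof.
pose c l := 2 * normal_pdf 0 (Num.sqrt (sigma2 l / 2)) 1.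
have c0 l : 0 < c l.
  by rewrite mulr_gt0// normal_pdfE// mulr_gt0 ?normal_peak_gt0// expR_gt0.
pose m := \big[Num.min/1]_l c l.
exists m; first by rewrite lt_bigmin.
move=> [l b] a a01; rewrite normG//.
apply: le_trans (normal_prob_sym_itv_ge (std_neq0 l) a01).
by rewrite lee_fin ler_wpM2r ?(andP a01).1// bigmin_le_cond.
Qed.

Let measurable_gain i a : measurable (G i @^-1` `]- a, a[%classic).
Proof. by rewrite -[X in measurable X]setTI; exact: measurable_funP. Qed.

(** Bounding components rather than moduli gives an intersection of independent events, two per
    link, whence the exponents [#|L| * 2]. *)
Definition small_gains L a : set T :=
  \bigcap_(i in [set j | j \in finset.setX L [set: bool]])
    (G i @^-1` `]- a, a[%classic).

Lemma measurable_small_gains L a : measurable (small_gains L a).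
Proof.
apply: fin_bigcap_measurable; first exact: finite_finset.
by move=> i _; exact: measurable_gain.
Qed.

Lemma small_gainsP L a w :
  small_gains L a w <-> forall l b, l \in L -> `|G (l, b) w| < a.
Proof.
split=> [h l b lL|h [l b]].
  have := h (l, b); rewrite /= finset.inE/= lL finset.inE => /(_ isT).
  by rewrite in_itv/= ltr_norml.
by rewrite /= finset.inE/= => /andP[lL _]; rewrite in_itv/= -ltr_norml h.
Qed.

Lemma prob_small_gains L a : P (small_gains L a) =
  (\prod_(i in finset.setX L [set: bool])
     fine (P (G i @^-1` `](- a)%R, a[%classic)))%:E.
Proof.
rewrite /small_gains indepG// -prodEFin; apply: eq_bigr => i _.
by rewrite fineK// fin_num_measure.
Qed.

Let card_links L : #|finset.setX L [set: bool]| = (#|L| * 2)%N.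
Proof. by rewrite cardsX cardsT card_bool. Qed.

Lemma prob_small_gains_le : exists2 C, 0 < C & forall L a, 0 <= a ->
  (P (small_gains L a) <= ((C * a) ^+ (#|L| * 2))%:E)%E.
Proof.
have [C C0 hC] := gain_prob_le; exists C => // L a a0.
rewrite prob_small_gains lee_fin -card_links -prodr_const; apply: ler_prod => i _.
by rewrite fine_ge0//= -lee_fin fineK ?hC// fin_num_measure.
Qed.

Lemma prob_small_gains_ge : exists2 c, 0 < c & forall L a, 0 <= a <= 1 ->
  (((c * a) ^+ (#|L| * 2))%:E <= P (small_gains L a))%E.
Proof.
have [c c0 hc] := gain_prob_ge; exists c => // L a a01.
rewrite prob_small_gains lee_fin -card_links -prodr_const; apply: ler_prod => i _.
have /andP[a0 _] := a01; rewrite mulr_ge0//; last exact: ltW.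
rewrite andTb -lee_fin fineK ?hc//.
by rewrite fin_num_measure.
Qed.

(** One link on each of the three paths from source to destination: those that an outage with
    decoding pattern [(d1, d2)] forces to be weak. *)
Definition failing_links (d1 d2 : bool) : {set link} :=
  (l_SD |: ((if d1 then l_R1D else l_SR1) |:
    [set (if d2 then l_R2D else l_SR2)]))%SET.

Lemma card_failing_links d1 d2 : #|failing_links d1 d2| = 3%N.
Proof.
by rewrite /failing_links; case: d1; case: d2;
  rewrite cardsU1 !finset.inE cardsU1 !finset.inE cards1.
Qed.

(** * Asymptotics of the outage probability *)

Variables (Bw tau1 tau2 r : R).
Hypotheses (r_gt0 : 0 < r) (r_lt2V : r < 2^-1) (Bw_gt0 : 0 < Bw).
Hypothesis tau12 : tau1 != tau2.

Let rate snr := target_rate r snr (sigma2 l_SD).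
Let out snr := outage_prob G (sigma2 l_SD) Bw tau1 tau2 r snr.
Let outage snr := [set w | I_RTDA Bw tau1 tau2 snr (rate snr)
                     (fun l b => G (l, b) w) < rate snr].

Let rate_ge0 snr : 0 <= snr -> 0 <= rate snr.
Proof.
move=> snr0; apply: mulr_ge0; first exact: ltW.
by apply: ln_ge0; rewrite lerDl mulr_ge0// ltW.
Qed.

(** For [snr >= 1] the [1] inside the logarithm is at most [snr], so the rate is [r * ln snr] up to
    a constant. *)
Let rate_le snr : 1 <= snr -> rate snr <= r * (ln (1 + sigma2 l_SD) + ln snr).
Proof.
move=> snr1; have snr0 : 0 < snr by apply: lt_le_trans snr1.
have s0 := sigma2_gt0 l_SD.
rewrite /rate /target_rate ler_pM2l// -lnM ?posrE//; last by lra.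
by rewrite ler_ln ?posrE//; nra.
Qed.

Let rate_ge snr : 1 <= snr -> r * (ln (sigma2 l_SD) + ln snr) <= rate snr.
Proof.
move=> snr1; have snr0 : 0 < snr by apply: lt_le_trans snr1.
have s0 := sigma2_gt0 l_SD.
rewrite /rate /target_rate ler_pM2l// -lnM ?posrE//.
by rewrite ler_ln ?posrE//; nra.
Qed.

Let outE snr : 0 <= snr -> P (outage snr) = (out snr)%:E.
Proof.
by move=> snr0; rewrite fineK// fin_num_measure//; exact: measurable_outage.
Qed.

(** The decoding pattern is random; a union over all four patterns leaves events about fixed sets of
    links, to which independence applies. *)
Lemma outage_subset eta : 0 < eta < 1 ->
  exists2 delta, 0 < delta <= 1 & forall snr a, 0 < snr -> 0 <= a ->
    expR (2 * rate snr / (1 - eta)) <= delta * rho0 snr * a ^+ 2 ->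
    outage snr `<=` \bigcup_(d in [set: bool * bool])
      small_gains (failing_links d.1 d.2) a.
Proof.
move=> eta01; have /andP[eta0 eta1] := eta01.
have [delta /andP[delta0 delta1] hd] := outage_gain_lt Bw_gt0 tau12 eta01.
exists delta; first by rewrite delta0.
move=> snr a snr0 a0 ha w.
have rho : 0 < rho0 snr by rewrite /rho0; lra.
have rt0 := rate_ge0 (ltW snr0).
move=> /(hd snr (rate snr) (fun l b => G (l, b) w) (ltW snr0) rt0).
pose n l := cnorm2 (G (l, false) w) (G (l, true) w).
have n0 l : 0 <= n l := cnorm2_ge0 _ _.
pose dec l := decodes snr (rate snr) (G (l, false) w) (G (l, true) w).
rewrite -!/(n _) -!/(dec _) => lt.
exists (dec l_SR1, dec l_SR2) => //; apply/small_gainsP.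
suff nlt l : l \in failing_links (dec l_SR1) (dec l_SR2) -> n l < a ^+ 2.
  move=> l b /nlt nl; rewrite -(ltr_pXn2r (n := 2)) ?nnegrE// real_normK ?num_real//.
  apply: le_lt_trans nl; rewrite /n /cnorm2.
  by case: b; rewrite ?lerDl ?lerDr sqr_ge0.
have dr : 0 < delta * rho0 snr by rewrite mulr_gt0.
move=> lL; rewrite -(ltr_pM2l dr); apply: lt_le_trans ha.
(* Failure to decode bounds the gain by [expR (2 * rate)]; both [delta <= 1] and [1 - eta < 1] only
   weaken this to the common threshold. *)
have fail k : ~~ dec k -> delta * rho0 snr * n k < expR (2 * rate snr / (1 - eta)).
  rewrite /dec /decodes -ltNge -/(n k) => nk.
  have : 1 + rho0 snr * n k < expR (2 * rate snr).
    rewrite -ltr_ln ?posrE ?expR_gt0//; last by rewrite ltr_pwDl// mulr_ge0// ltW.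
    by rewrite expRK; lra.
  have : expR (2 * rate snr) <= expR (2 * rate snr / (1 - eta)).
    by rewrite ler_expR ler_pdivlMr; [nra|lra].
  have : delta * (rho0 snr * n k) <= rho0 snr * n k.
    by rewrite ler_piMl// mulr_ge0// ltW.
  by rewrite mulrA; lra.
have hD := mulr_ge0 (ltW dr) (n0 l_SD).
have h1 := mulr_ge0 (ltW dr) (n0 l_R1D).
have h2 := mulr_ge0 (ltW dr) (n0 l_R2D).
(* All terms being nonnegative, the sum bounds the direct link and the second hop of each decoding
   relay. *)
have {}lt : delta * rho0 snr * n l_SD + (dec l_SR1)%:R * (delta * rho0 snr * n l_R1D)
    + (dec l_SR2)%:R * (delta * rho0 snr * n l_R2D) < expR (2 * rate snr / (1 - eta)).
  by apply: le_lt_trans lt; nra.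
have := fail l_SR1; have := fail l_SR2.
move: lL lt; rewrite !finset.inE.
case: (dec l_SR1); case: (dec l_SR2) => /= /or3P[] /eqP -> lt f1 f2;
  rewrite ?mul1r ?mul0r ?addr0 in lt; by [lra|exact: f1|exact: f2].
Qed.

(** Each of the four patterns contributes at most [C ^ 6 * t ^ 3], with [t] of order
    [snr ^ (2 r / (1 - eta) - 1)]. *)
Lemma ln_outage_le eta : 0 < eta < 1 -> exists K, forall snr, 1 <= snr ->
  0 < out snr -> ln (out snr) <= K + (6 * r / (1 - eta) - 3) * ln snr.
Proof.
move=> eta01; have /andP[eta0 eta1] := eta01.
have [delta /andP[delta0 delta1] hsub] := outage_subset eta01.
have [C C0 hC] := prob_small_gains_le.
exists (ln 4 + ln C *+ 6 + 
  3 * (2 * r * ln (1 + sigma2 l_SD) / (1 - eta) - ln delta - ln (2 / 3))).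
move=> snr snr1 out0; have snr0 : 0 < snr by apply: lt_le_trans snr1.
have rho : 0 < rho0 snr by rewrite /rho0; lra.
have dr : 0 < delta * rho0 snr by rewrite mulr_gt0.
(* The least value of [a ^ 2] that [outage_subset] accepts. *)
pose t := expR (2 * rate snr / (1 - eta)) / (delta * rho0 snr).
have t0 : 0 < t by rewrite divr_gt0// expR_gt0.
have st2 : Num.sqrt t ^+ 2 = t by rewrite sqr_sqrtr// ltW.
have le_out : out snr <= 4 * (C ^+ 6 * t ^+ 3).
  rewrite -lee_fin -(outE (ltW snr0)).
  pose B b1 b2 := small_gains (failing_links b1 b2) (Num.sqrt t).
  have hB b1 b2 : (P (B b1 b2) <= (C ^+ 6 * t ^+ 3)%:E)%E.
    by have := hC (failing_links b1 b2) _ (sqrtr_ge0 t);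
      rewrite card_failing_links exprMn (exprM (Num.sqrt t) 2 3) st2.
  have mB b1 b2 : measurable (B b1 b2) := measurable_small_gains _ _.
  apply: (@le_trans _ _ (P ((B true true `|` B true false) `|`
      (B false true `|` B false false)))).
    apply: le_measure; rewrite ?inE.
    - by apply: measurable_outage; exact: ltW.
    - by do 2?apply: measurableU.
    move=> w /(hsub snr (Num.sqrt t) snr0 (sqrtr_ge0 _)) [].
      by rewrite st2 [leRHS]mulrC divfK// gt_eqF.
    by move=> [[] []] _ ?; [left; left|left; right|right; left|right; right].
  apply: le_trans (measureU2 _ _ _) _; try exact: measurableU.
  apply: (@le_trans _ _ (((C ^+ 6 * t ^+ 3)%:E + (C ^+ 6 * t ^+ 3)%:E) +
    ((C ^+ 6 * t ^+ 3)%:E + (C ^+ 6 * t ^+ 3)%:E))%E).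
    by apply: leeD; apply: le_trans (measureU2 _ _ _) _ => //; apply: leeD; exact: hB.
  by rewrite -!EFinD lee_fin; lra.
have lnt : ln t = 2 * rate snr / (1 - eta) - ln delta - (ln (2 / 3) + ln snr).
  by rewrite ln_div ?posrE ?expR_gt0// expRK lnM ?posrE// /rho0 lnM ?posrE//; lra.
apply: (@le_trans _ _ (ln (4 * (C ^+ 6 * t ^+ 3)))).
  by rewrite ler_ln ?posrE// mulr_gt0// mulr_gt0// exprn_gt0.
rewrite (lnM (x := 4)) ?posrE//; last by rewrite mulr_gt0// exprn_gt0.
rewrite lnM ?posrE ?exprn_gt0// (lnXn 6 C0) (lnXn 3 t0) lnt.
have : 2 * rate snr / (1 - eta) <=
    2 * r * ln (1 + sigma2 l_SD) / (1 - eta) + 2 * r / (1 - eta) * ln snr.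
  rewrite (_ : _ + _ = 2 * (r * (ln (1 + sigma2 l_SD) + ln snr)) / (1 - eta)); last by ring.
  by rewrite ler_pM2r ?invr_gt0 ?subr_gt0// ler_pM2l// rate_le.
rewrite (_ : 6 * r / (1 - eta) = 3 * (2 * r / (1 - eta))); last by ring.
move: (2 * rate snr / _) (2 * r * _ / _) (2 * r / _) => x y z; nra.
Qed.

Lemma ln_outage_ge : exists K M : R, forall snr, 1 <= snr -> M <= ln snr ->
  0 < out snr /\ K + (6 * r - 3) * ln snr <= ln (out snr).
Proof.
have [c c0 hc] := prob_small_gains_ge.
(* Once [ln snr] exceeds [L1], [expR (2 * rate)] is at least [2]; once it exceeds [L2], which relies
   on [r < 1 / 2], it is at most [snr]. *)
pose L1 := (ln 2 / 2 - r * ln (sigma2 l_SD)) / r.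
pose L2 := 2 * r * ln (1 + sigma2 l_SD) / (1 - 2 * r).
exists (ln c *+ 6 + 3 * (2 * r * ln (sigma2 l_SD) - ln 4 - ln (2 / 3))).
exists (`|L1| + `|L2|) => snr snr1 hL.
have snr0 : 0 < snr by apply: lt_le_trans snr1.
have rho : 0 < rho0 snr by rewrite /rho0; lra.
have hL1 : L1 <= ln snr.
  by have := ler_norm L1; have := normr_ge0 L2; lra.
have hL2 : L2 <= ln snr.
  by have := ler_norm L2; have := normr_ge0 L1; lra.
have rge := rate_ge snr1; have rle := rate_le snr1.
have rate2 : ln 2 <= 2 * rate snr.
  by move: hL1; rewrite /L1 ler_pdivrMr//; lra.
have rateL : 2 * rate snr <= ln snr.
  have r21 : 0 < 1 - 2 * r by rewrite subr_gt0 mulrC -ltr_pdivlMr// div1r.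
  by move: hL2; rewrite /L2 ler_pdivrMr//; nra.
have e2 : 2 <= expR (2 * rate snr) by rewrite -[leLHS]lnK ?posrE// ler_expR.
have eL : expR (2 * rate snr) <= snr by rewrite -[leRHS]lnK ?posrE// ler_expR.
(* The factor [4] makes [2 * rho0 * t] half of [expR (2 * rate)], which is at most
   [expR (2 * rate) - 1] as the exponential is at least [2]. *)
pose t := expR (2 * rate snr) / (4 * rho0 snr).
have t0 : 0 < t by rewrite divr_gt0 ?expR_gt0// mulr_gt0.
have st2 : Num.sqrt t ^+ 2 = t by rewrite sqr_sqrtr// ltW.
have t1 : t <= 1 by rewrite ler_pdivrMr ?mulr_gt0// /rho0; lra.
have tE : 4 * rho0 snr * t = expR (2 * rate snr).
  by rewrite mulrC divfK// gt_eqF// mulr_gt0.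
have le_out : c ^+ 6 * t ^+ 3 <= out snr.
  rewrite -lee_fin -(outE (ltW snr0)).
  have a01 : 0 <= Num.sqrt t <= 1.
    by rewrite sqrtr_ge0/= -(ler_pXn2r (n := 2)) ?nnegrE ?sqrtr_ge0// st2 expr1n.
  (* When no relay decodes, the failing links are exactly the three of [small_gains_outage]. *)
  have := hc (failing_links false false) _ a01.
  rewrite card_failing_links exprMn (exprM (Num.sqrt t) 2 3) st2 => h.
  apply: le_trans h _; apply: le_measure; rewrite ?inE.
  - exact: measurable_small_gains.
  - by apply: measurable_outage; exact: ltW.
  move=> w /small_gainsP small.
  apply: (@small_gains_outage _ _ _ _ _ _ (Num.sqrt t)) => //.
    by rewrite st2; nra.
  by move=> l b lL; apply: small; rewrite !finset.inE; move: lL;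
    rewrite !in_cons in_nil orbF => /or3P[] ->; rewrite ?orbT.
have ct0 : 0 < c ^+ 6 * t ^+ 3 by rewrite mulr_gt0 ?exprn_gt0.
have out0 : 0 < out snr by apply: lt_le_trans le_out.
split => //; apply: (@le_trans _ _ (ln (c ^+ 6 * t ^+ 3))); last by rewrite ler_ln.
have lnt : ln t = 2 * rate snr - (ln 4 + (ln (2 / 3) + ln snr)).
  by rewrite ln_div ?posrE ?expR_gt0 ?mulr_gt0// expRK lnM ?posrE// /rho0 lnM ?posrE//; lra.
rewrite [leRHS]lnM ?posrE ?exprn_gt0// (lnXn 6 c0) (lnXn 3 t0) lnt; lra.
Qed.

Lemma diversity_ratio_near (e : R) : 0 < e -> \forall snr \near +oo,
  3 - 6 * r - e <= - ln (out snr) / ln snr <= 3 - 6 * r + e.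
Proof.
move=> e0.
(* chosen so that [6 r / (1 - eta) = 6 r + e / 2] *)
pose eta := (e / 2) / (6 * r + e / 2).
have den0 : 0 < 6 * r + e / 2 by rewrite addr_gt0 ?mulr_gt0 ?divr_gt0.
have etaE : 1 - eta = 6 * r / (6 * r + e / 2).
  apply: (mulIf (lt0r_neq0 den0)).
  by rewrite mulrBl !divfK ?lt0r_neq0// mul1r addrK.
have eta01 : 0 < eta < 1.
  by rewrite divr_gt0 ?divr_gt0//= ltr_pdivrMr// mul1r ltrDr mulr_gt0.
have [K hK] := ln_outage_le eta01.
have [K' [M hM]] := ln_outage_ge.
near=> snr.
have snr1 : 1 <= snr by near: snr; exact: nbhs_pinfty_ge.
have snr0 : 0 < snr by apply: lt_le_trans snr1.
have lnsnr B : expR B <= snr -> B <= ln snr.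
  by move=> ?; rewrite -[leLHS]expRK ler_ln ?posrE ?expR_gt0.
have L0 : 1 <= ln snr by apply: lnsnr; near: snr; exact: nbhs_pinfty_ge.
have LM : M <= ln snr by apply: lnsnr; near: snr; exact: nbhs_pinfty_ge.
(* [K] is absorbed by the half of [e] not spent on [eta]; [K'] may use all of [e], since the lower
   bound on the outage involves no [eta]. *)
have LK : K / (e / 2) <= ln snr by apply: lnsnr; near: snr; exact: nbhs_pinfty_ge.
have LK' : - K' / e <= ln snr by apply: lnsnr; near: snr; exact: nbhs_pinfty_ge.
have Lpos : 0 < ln snr by apply: lt_le_trans L0.
have [out0 ge] := hM _ snr1 LM; have := hK _ snr1 out0.
have -> : 6 * r / (1 - eta) = 6 * r + e / 2.
  by rewrite etaE invf_div mulrC divfK// gt_eqF// mulr_gt0.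
rewrite ler_pdivrMr ?divr_gt0// in LK; rewrite ler_pdivrMr// in LK'.
by rewrite ler_pdivrMr// ler_pdivlMr// => le; apply/andP; split; nra.
Unshelve. all: by end_near. Qed.

End small_gains.

(** * Bounds on the diversity-multiplexing tradeoff *)

Theorem theorem4 (d : measure_display) (T : measurableType d) (R : realType)
  (P : probability T R) (G : link * bool -> {RV P >-> R}) (sigma2 : link -> R)
  (Bw tau1 tau2 r : R) :
  (forall l, 0 < sigma2 l) ->
  mutually_independent G ->
  (forall l b, has_law_normal (G (l, b)) (sigma2 l)) ->
  0 < r < 2^-1 -> 0 < Bw ->
  1 <= `|tau2 - tau1| * Bw ->
  let T0Bw := `|tau2 - tau1| * Bw in
  let Delta1 := (Num.floor T0Bw)%:~R / (Num.ceil T0Bw)%:~R : R in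
  let div := diversity_ratio G (sigma2 l_SD) Bw tau1 tau2 r in
  ((3 - 6 * r / Delta1)%:E <= limf_einf div (pinfty_nbhs R))%E /\
  (limf_einf div (pinfty_nbhs R) <= limf_esup div (pinfty_nbhs R))%E /\
  (limf_esup div (pinfty_nbhs R) <= (3 - 6 * r)%:E)%E /\
  ((exists n : nat, T0Bw = n%:R) ->
     limf_einf div (pinfty_nbhs R) = (3 - 6 * r)%:E /\
     limf_esup div (pinfty_nbhs R) = (3 - 6 * r)%:E).
Proof.
move=> s0 indep norm /andP[r0 r2] Bw0 TB T0Bw Delta1 div.
have tau12 : tau1 != tau2.
  by apply/eqP => tauE; move: TB; rewrite tauE subrr normr0 mul0r ler10.
have [infE supE] := limf_einf_esup_unique _
  (diversity_ratio_near s0 indep norm r0 r2 Bw0 tau12).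
have -> : limf_einf div (pinfty_nbhs R) = (3 - 6 * r)%:E by exact: infE.
have -> : limf_esup div (pinfty_nbhs R) = (3 - 6 * r)%:E by exact: supE.
split; last by rewrite lexx.
(* A floor of at least [1] makes [Delta1] positive; with [Delta1 <= 1] this gives
   [6 * r <= 6 * r / Delta1]. *)
have fl1 : (1 : int) <= Num.floor T0Bw by rewrite floor_ge_int.
have fc : Num.floor T0Bw <= Num.ceil T0Bw.
  by rewrite -(ler_int R) (le_trans (Num.Theory.floor_le _))// Num.Theory.ceil_ge.
have f0 : 0 < Num.floor T0Bw by apply: lt_le_trans fl1.
have c0 : 0 < Num.ceil T0Bw by apply: lt_le_trans fc.
have D0 : 0 < Delta1 by rewrite divr_gt0// ltr0z.
have D1 : Delta1 <= 1 by rewrite ler_pdivrMr ?mul1r ?ler_int// ltr0z.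
rewrite lee_fin lerD2l lerN2 ler_pdivlMr// ler_piMr//; lra.
Qed.
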